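(* Let $N\ge 1$, $p=(p_1,\dots,p_N)\in[0,1]^N$, let $\zeta=(\zeta_1,\dots,\zeta_N)\in\{0,1\}^N$ be a collection of independent Bernoulli trials with success probabilities $p_1,\dots,p_N$, let $Z=\sum_{i=1}^N\zeta_i$, $w_j=\frac{p_j}{1-p_j}$, and $$S=\{1,\dots,N\},\quad O=\{i\in S: p_i=0\},\quad I=\{i\in S: p_i=1\},\quad V=S\setminus(I\cup O).$$ Then the probability mass function of the conditional Bernoulli model over the closed domain $p\in[0,1]^N$ is $$\mathbb P(\zeta\mid Z=z)=\begin{cases}\dfrac{\prod_{j\in V}w_j^{\zeta_j}}{R(z-|I|,V)} & \text{if }\zeta_j=p_j\ \text{for all } j\in I\cup O\ \text{and}\ \sum_{j\in V}\zeta_j=z-|I|,\\[1ex] 0 & \text{otherwise.}\end{cases}$$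
   Context: The conditional Bernoulli model $\mathbb P(\zeta\mid Z=z)$ describes the probability of a realization $\zeta\in\{0,1\}^N$ of the $N$ Bernoulli trials conditioned on their sum $Z$ being equal to $z$; for non-degenerate success probabilities $p\in(0,1)^N$ its probability mass function is $\prod_{i=1}^N w_i^{\zeta_i}/R(z,S)$. For an integer $k$ and $A\subseteq S$, $R(k,A)=\sum_{B\subseteq A,\ |B|=k}\prod_{i\in B}w_i$, with $R(0,A)=1$ and $R(k,A)=0$ if $k<0$ or $k>|A|$. *)

(* Defs.v *)
From HB Require Import structures.
From mathcomp Require Import all_boot all_order all_algebra.
From mathcomp Require Import all_classical all_reals all_analysis.

Set Implicit Arguments.
Unset Strict Implicit.
Unset Printing Implicit Defensive.

Import Order.TTheory GRing.Theory Num.Theory.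

Local Open Scope classical_set_scope.
Local Open Scope ring_scope.

(* Mutual independence: the product rule over every subfamily of a finite
   family of random variables. *)
Definition mutually_independent (d d' : measure_display) (T : measurableType d)
    (T' : measurableType d') (R : realType) (P : probability T R)
    (K : finType) (X : K -> {RV P >-> T'}) : Prop :=
  forall (J : {set K}) (A : K -> set T'),
    (forall i, i \in J -> measurable (A i)) ->
    P (\bigcap_(i in [set` J]) (X i @^-1` A i)) =
      (\prod_(i in J) P (X i @^-1` A i))%E.

(* Elementary conditional probability. When [P B = 0], division by zero in a
   field makes this 0. *)
Definition cond_prob (d : measure_display) (T : measurableType d)
    (R : realType) (P : probability T R) (A B : set T) : R :=
  fine (P (A `&` B)) / fine (P B).

Definition num_successes (d : measure_display) (T : measurableType d)
    (R : realType) (P : probability T R) (N : nat)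
    (zeta : 'I_N -> {RV P >-> bool}) (t : T) : nat :=
  (\sum_(i < N) zeta i t)%N.

(* The conditional Bernoulli model: the probability of the realization [x] of
   the trials given that their sum is [z]. *)
Definition cond_bernoulli_pmf (d : measure_display) (T : measurableType d)
    (R : realType) (P : probability T R) (N : nat)
    (zeta : 'I_N -> {RV P >-> bool}) (z : int) (x : 'I_N -> bool) : R :=
  cond_prob P [set t | forall i, zeta i t = x i]
              [set t | (num_successes zeta t)%:Z = z].

(* Only meaningful for [p j != 1]. *)
Definition odds (R : realType) (N : nat) (p : 'I_N -> R) (j : 'I_N) : R :=
  p j / (1 - p j).

Definition zero_trials (R : realType) (N : nat) (p : 'I_N -> R) : {set 'I_N} :=
  [set i | p i == 0]%SET.

Definition one_trials (R : realType) (N : nat) (p : 'I_N -> R) : {set 'I_N} :=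
  [set i | p i == 1]%SET.

Definition random_trials (R : realType) (N : nat) (p : 'I_N -> R) :
    {set 'I_N} :=
  ([set: 'I_N] :\: (one_trials p :|: zero_trials p))%SET.

(* The function R(k, A). The sum is empty when [k < 0] or [k > #|A|], and is
   reduced to the empty product when [k = 0]. *)
Definition subset_weight (R : realType) (N : nat) (w : 'I_N -> R)
    (k : int) (A : {set 'I_N}) : R :=
  \sum_(B : {set 'I_N} | (B \subset A) && (#|B|%:Z == k)) \prod_(i in B) w i.

(* Main.v *)
Require Import Defs.
From HB Require Import structures.
From mathcomp Require Import all_boot all_order all_algebra.
From mathcomp Require Import all_classical all_reals all_analysis.

(* Write V for the non-degenerate trials and C for the product of the 1 - p_j
   over V. A realization that agrees with p on the degenerate trials has
   probability C * prod_(j in V) w_j ^ x_j; any other one is null. Summing over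
   the realizations with z successes gives P(Z = z) = C * R(z - |I|, V), and the
   nonzero constant C cancels in the ratio. *)

Set Implicit Arguments.
Unset Strict Implicit.
Unset Printing Implicit Defensive.

Import Order.TTheory GRing.Theory Num.Theory.

Local Open Scope classical_set_scope.
Local Open Scope ring_scope.

Section closed_domain.
Variables (R : realType) (N : nat) (p : 'I_N -> R).

Local Notation V := (random_trials p).
Local Notation I := (one_trials p).
Local Notation O := (zero_trials p).
Local Notation agrees x :=
  [forall j in (one_trials p :|: zero_trials p)%SET, (x j)%:R == p j].
(** The constant C: the probability that all the non-degenerate trials fail. *)
Local Notation nullity := (\prod_(j in random_trials p) (1 - p j)).

Lemma random_trialsC : V = (~: (I :|: O))%SET.
Proof. exact: finset.setTD. Qed.

Lemma in_random_trials j : (j \in V) = (p j != 0) && (p j != 1).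
Proof. by rewrite random_trialsC !inE negb_or andbC. Qed.

Lemma nullity_neq0 : nullity != 0.
Proof.
apply/prodf_neq0 => j; rewrite in_random_trials => /andP[_ pj1].
by rewrite subr_eq0 eq_sym.
Qed.

(** On [V] each factor is [1 - p j] times a power of the odds, since [p j != 1]. A degenerate trial
    contributes 1 if [x j] agrees with [p j], and a single disagreement contributes a factor 0. *)
Lemma prod_bernoulli_pmf (x : 'I_N -> bool) :
  \prod_i bernoulli_pmf (p i) (x i) =
    if agrees x then nullity * \prod_(j in V) odds p j ^+ x j else 0.
Proof.
case: ifPn => [/forall_inP xp|/forall_inPn[j jIO xpj]].
  rewrite (bigID (mem V)) /= [X in _ * X]big1 ?mulr1 => [|j].
    rewrite -big_split; apply: eq_bigr => j.
    rewrite in_random_trials => /andP[_ pj1] /=.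
    rewrite /bernoulli_pmf /odds; case: (x j); rewrite ?mulr1 ?expr0 ?expr1 //.
    by rewrite mulrC divfK // subr_eq0 eq_sym.
  rewrite random_trialsC inE negbK => /xp /eqP <-.
  by rewrite /bernoulli_pmf; case: (x j); rewrite ?subr0.
rewrite (bigD1 j) //= (_ : bernoulli_pmf _ _ = 0) ?mul0r //.
by move: jIO xpj; rewrite !inE /bernoulli_pmf => /orP[] /eqP ->;
  case: (x j); rewrite ?eqxx ?subrr.
Qed.

(** The source of the shift by [#|I|]: agreement forces a success at each trial of [I] and a failure
    at each trial of [O]. *)
Lemma sum_agreeing_trials (x : 'I_N -> bool) :
  agrees x -> (\sum_i x i)%N = (#|I| + \sum_(j in V) x j)%N.
Proof.
move=> /forall_inP xp; rewrite (bigID (mem V)) /= addnC; congr addn.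
rewrite -sum1_card [RHS]big_mkcond [LHS]big_mkcond; apply: eq_bigr => j _ /=.
have := xp j; rewrite random_trialsC !inE negbK.
case: eqP => [-> /(_ isT)|_] /=.
  by case: (x j); rewrite // eq_sym oner_eq0.
by case: eqP => [-> /(_ isT)|//]; case: (x j); rewrite ?oner_eq0.
Qed.

(* A success set of positive probability is [I] together with a subset of
   [V]. *)
Lemma sum_prod_bernoulli_pmf (z : int) :
  \sum_(B : {set 'I_N} | #|B|%:Z == z)
      \prod_i bernoulli_pmf (p i) (i \in B) =
    nullity * subset_weight (odds p) (z - #|I|%:Z) V.
Proof.
under [LHS]eq_bigr => B _ do rewrite (prod_bernoulli_pmf [in B]).
rewrite -big_mkcondr /= -big_distrr /=; congr (_ * _).
have VI (A : {set 'I_N}) : A \subset V -> (I :&: A = finset.set0)%SET.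
  move=> /fintype.subsetP AV; apply/setP => j; rewrite !inE.
  case: eqP => [pj|//]; apply/negP => /AV.
  by rewrite in_random_trials pj eqxx andbF.
(* An agreeing [B] contains [I] and misses [O], so it is recovered from [A = B :&: V] as
   [I :|: A]. *)
rewrite (reindex_onto (fun A => I :|: A)%SET (fun B => B :&: V)%SET) /=;
  last first.
  move=> B /andP[_ /forall_inP Bp]; apply/setP => j; rewrite !inE.
  have := Bp j; rewrite !inE.
  case: eqP => [-> /(_ isT)|_] /=.
    by case: (j \in B); rewrite // eq_sym oner_eq0.
  case: eqP => [-> /(_ isT)|_] /=; last by rewrite andbT.
  by case: (j \in B); rewrite // oner_eq0.
have capV (A : {set 'I_N}) : ((I :|: A) :&: V = A :&: V)%SET.
  by apply/setP => j; rewrite !inE; case: eqP => //= _; rewrite andbF.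
apply: eq_big => [A|A].
  rewrite capV.
  have -> : (A :&: V == A)%SET = (A \subset V) by apply/eqP/finset.setIidPl.
  case: (boolP (A \subset V)) => [AV|]; last by rewrite andbF.
  rewrite andbT /= cardsU (VI _ AV) cards0 subn0 PoszD.
  (* For [A \subset V], agreement of [I :|: A] is automatic; the size condition becomes
     [#|A| = z - #|I|] by disjointness. *)
  rewrite [X in _ && X](_ : _ = true) ?andbT /=.
    by rewrite [RHS]eq_sym subr_eq eq_sym addrC.
  apply/forall_inP => j; rewrite !inE.
  case: eqP => [-> //|_] /=; case: eqP => // pj0 _.
  case: (boolP (j \in A)) => [/(fintype.subsetP AV)|]; rewrite ?pj0 //.
  by rewrite in_random_trials pj0 eqxx.
rewrite capV => /andP[_ /eqP /finset.setIidPl AV].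
(* Trials of [V] outside [A] have exponent 0, so the product over [V] reduces to one over [A]. *)
rewrite [LHS]big_mkcond [RHS]big_mkcond; apply: eq_bigr => j _ /=.
case: ifPn => [|jV].
  rewrite in_random_trials finset.in_setU [j \in I]inE => /andP[_ /negPf ->] /=.
  by case: (j \in A); rewrite ?expr1 ?expr0.
by case: ifP => // /(fintype.subsetP AV) jV'; rewrite jV' in jV.
Qed.

End closed_domain.

Section independent_trials.
Context (d : measure_display) (T : measurableType d) (R : realType).
Variables (P : probability T R) (N : nat) (p : 'I_N -> R).
Variable zeta : 'I_N -> {RV P >-> bool}.
Hypothesis p01 : forall i, 0 <= p i <= 1.
Hypothesis zeta_bernoulli :
  forall i, distribution P (zeta i) =1 bernoulli_prob (p i).
Hypothesis zeta_independent : mutually_independent zeta.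

(** Puts the event in the form to which the product rule of [mutually_independent] applies, with the
    full index set as subfamily. *)
Lemma realizationE (x : 'I_N -> bool) :
  [set t | forall i, zeta i t = x i] =
    \bigcap_(i in [set` [set: 'I_N]%SET]) (zeta i @^-1` [set x i]).
Proof.
by apply/seteqP; split => t /= tx i => [_|]; [|apply: tx; rewrite /= inE].
Qed.

Lemma measurable_realization (x : 'I_N -> bool) :
  measurable [set t | forall i, zeta i t = x i].
Proof.
rewrite realizationE; apply: fin_bigcap_measurable => // i _.
by rewrite -[X in measurable X]setTI; exact: measurable_funP.
Qed.

Lemma probability_realization (x : 'I_N -> bool) :
  P [set t | forall i, zeta i t = x i] =
    (\prod_i bernoulli_pmf (p i) (x i))%:E.
Proof.
rewrite realizationE zeta_independent // -prodEFin.
apply: eq_big => [i|i _]; first by rewrite inE.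
have /= := zeta_bernoulli i [set x i]; rewrite /distribution /pushforward => ->.
by rewrite /bernoulli_prob p01 fsbig_set1.
Qed.

(** The event splits into finitely many disjoint realization events, one for each success set [B] of
    size [z]; a negative [z] leaves no such set. *)
Lemma probability_num_successes (z : int) :
  P [set t | (num_successes zeta t)%:Z = z] =
    (\sum_(B : {set 'I_N} | #|B|%:Z == z)
       \prod_i bernoulli_pmf (p i) (i \in B))%:E.
Proof.
pose F (B : {set 'I_N}) := [set t | forall i, zeta i t = (i \in B)].
pose D := enum [pred B : {set 'I_N} | #|B|%:Z == z].
have FE : [set t | (num_successes zeta t)%:Z = z] = \bigcup_(B in [set` D]) F B.
  have cardE t (B : {set 'I_N}) : F B t -> num_successes zeta t = #|B|.
    move=> FBt; rewrite /num_successes -sum1_card [RHS]big_mkcond.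
    by apply: eq_bigr => i _; rewrite FBt; case: (i \in B).
  apply/seteqP; split => [t /= tz|t [B /=]]; last first.
    by rewrite mem_enum => /eqP <- /cardE ->.
  have Ft : F [set i | zeta i t]%SET t by move=> i; rewrite inE.
  exists [set i | zeta i t]%SET => //=.
  by rewrite mem_enum inE -(cardE _ _ Ft) tz.
rewrite FE measure_fin_bigcup //.
- rewrite -fsbig_seq ?enum_uniq // -sumEFin big_enum.
  by apply: eq_bigr => B _; rewrite -probability_realization.
(* Disjointness: an outcome common to [F A] and [F B] has both as its success set. *)
- move=> A B _ _ [t [FAt FBt]]; apply/setP => i.
  by rewrite -FAt -FBt.
- by move=> B _; exact: measurable_realization.
Qed.

End independent_trials.

Theorem theorem3p2 (d : measure_display) (T : measurableType d) (R : realType)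
    (P : probability T R) (N : nat) (p : 'I_N -> R)
    (zeta : 'I_N -> {RV P >-> bool}) :
  (1 <= N)%N ->
  (forall i, 0 <= p i <= 1) ->
  (forall i, distribution P (zeta i) =1 bernoulli_prob (p i)) ->
  mutually_independent zeta ->
  forall (z : int) (x : 'I_N -> bool),
    cond_bernoulli_pmf zeta z x =
      if [forall j in (one_trials p :|: zero_trials p)%SET, (x j)%:R == p j]
         && ((\sum_(j in random_trials p) x j)%N%:Z == z - #|one_trials p|%:Z)
      then (\prod_(j in random_trials p) odds p j ^+ x j)
             / subset_weight (odds p) (z - #|one_trials p|%:Z) (random_trials p)
      else 0.
Proof.
move=> _ p01 zeta_bernoulli zeta_independent z x.
have num_realization t : (forall i, zeta i t = x i) ->
    num_successes zeta t = (\sum_i x i)%N.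
  by move=> tx; apply: eq_bigr => i _; rewrite tx.
rewrite /cond_bernoulli_pmf /cond_prob.
rewrite (probability_num_successes p01 zeta_bernoulli zeta_independent) /=.
rewrite sum_prod_bernoulli_pmf.
(* If [x] does not have [z] successes, the numerator is the measure of the empty set and the
   quotient is 0, even over a null denominator. The condition on the right fails too: with
   agreement, [z - #|I|] successes on [V] would make [z] in total. *)
have [sxz|sxz] := eqVneq ((\sum_i x i)%N%:Z) z; last first.
  rewrite (_ : _ `&` _ = set0); last first.
    apply/seteqP; split => // t [/= /num_realization -> xz].
    by rewrite xz eqxx in sxz.
  rewrite measure0 mul0r; case: ifP => // /andP[xp /eqP xV].
  by move: sxz; rewrite (sum_agreeing_trials xp) PoszD xV addrC subrK eqxx.
rewrite (_ : _ `&` _ = [set t | forall i, zeta i t = x i]); last first.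
  apply/seteqP; split => [t []//|t tx]; split => //=.
  by rewrite num_realization.
rewrite (probability_realization p01 zeta_bernoulli zeta_independent) /=.
rewrite prod_bernoulli_pmf; case: ifPn => xp; last by rewrite mul0r.
rewrite /= -sxz (sum_agreeing_trials xp) PoszD addrC addKr eqxx.
(* The factor [nullity] of numerator and denominator cancels, being nonzero. *)
by rewrite -mulf_div divff ?mul1r ?nullity_neq0.
Qed.
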